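(* If $A\in\mathcal{PC}_{n}$ is a simple perturbed consistent matrix, then $\mathcal{E}(A)$ is convex.
   Context: An $n$-by-$n$ entrywise positive real matrix $A=[a_{ij}]$ is reciprocal if $a_{ji}=1/a_{ij}$ for all $1\le i,j\le n$ (so diagonal entries are $1$); $\mathcal{PC}_n$ denotes the set of such matrices. A matrix $A\in\mathcal{PC}_n$ is consistent if $a_{ik}=a_{ij}a_{jk}$ for all $i,j,k$. For an entrywise positive vector $w\in\mathbb{R}^n$, $w^{(-T)}$ is the row vector with entries $1/w_j$, so $ww^{(-T)}=[w_i/w_j]$. $A\in\mathcal{PC}_n$ is a simple perturbed consistent matrix if it is a reciprocal matrix obtained from a consistent matrix by changing two entries in symmetrically placed positions, i.e., there are a consistent matrix $C=[c_{ij}]\in\mathcal{PC}_n$ and indices $p\ne q$ such that $a_{ij}=c_{ij}$ for all $(i,j)\notin\{(p,q),(q,p)\}$. A positive vector $w\in\mathbb{R}^n$ is efficient for $A\in\mathcal{PC}_n$ if for every positive vector $v\in\mathbb{R}^n$, the entrywise inequality $|A-vv^{(-T)}|\le |A-ww^{(-T)}|$ (entrywise absolute values) implies that $v$ is proportional to $w$. $\mathcal{E}(A)$ denotes the set of all positive vectors efficient for $A$. *)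

(* Defs.v *)
From mathcomp Require Import all_boot all_order all_algebra.
From mathcomp Require Import classical_sets reals convex.

Set Implicit Arguments.
Unset Strict Implicit.
Unset Printing Implicit Defensive.

Import Order.TTheory GRing.Theory Num.Theory.
Local Open Scope classical_set_scope.
Local Open Scope ring_scope.

Definition positive_mx (R : realType) (m n : nat) (A : 'M[R]_(m, n)) : Prop :=
  forall i j, 0 < A i j.

Definition PC (R : realType) (n : nat) : set 'M[R]_n :=
  [set A | positive_mx A /\ forall i j, A j i = (A i j)^-1].

Definition consistent (R : realType) (n : nat) (A : 'M[R]_n) : Prop :=
  PC A /\ forall i j k, A i k = A i j * A j k.

(* The perturbation may be trivial, so that for n >= 2 a consistent matrix is
   itself simple perturbed consistent. *)
Definition simple_perturbed_consistent (R : realType) (n : nat)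
    (A : 'M[R]_n) : Prop :=
  PC A /\
  exists (C : 'M[R]_n) (p q : 'I_n),
    [/\ consistent C, p != q &
        forall i j, (i, j) <> (p, q) -> (i, j) <> (q, p) -> A i j = C i j].

(* w^(-T): the transpose of the entrywise inverse of w. *)
Definition invT (R : realType) (n : nat) (w : 'cV[R]_n) : 'rV[R]_n :=
  map_mx GRing.inv w^T.

Definition proportional (R : realType) (n : nat) (v w : 'cV[R]_n) : Prop :=
  exists c : R, v = c *: w.

Definition efficient (R : realType) (n : nat) (A : 'M[R]_n)
    (w : 'cV[R]_n) : Prop :=
  positive_mx w /\
  forall v : 'cV[R]_n, positive_mx v ->
    (forall i j, `|(A - v *m invT v) i j| <= `|(A - w *m invT w) i j|) ->
    proportional v w.

Definition efficient_set (R : realType) (n : nat) (A : 'M[R]_n) :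
    set 'cV[R]_n :=
  [set w | efficient A w].

Lemma mul_invTE (R : realType) (n : nat) (w : 'cV[R]_n) i j :
  (w *m invT w) i j = w i ord0 / w j ord0.
Proof. by rewrite !mxE big_ord1 !mxE. Qed.

(* Main.v *)
(** The entrywise order on errors is governed by the digraph with an edge
    i -> j when a_ij <= w_i / w_j: along such an edge, a vector v approximating
    A at least as well as w satisfies v_i / w_i <= v_j / w_j. Hence w is
    efficient when some strongly connected set of pairs consists of edges, and
    conversely every cut is crossed by an edge when w is efficient, since
    otherwise one side of the cut can be shrunk slightly. Let A be obtained from
    a consistent C by increasing the entry (p, q), and let there be an index
    other than p and q. Cutting along level sets of c_pi w_i shows that an
    efficient w has the edges p -> i -> q -> p for all other i, and these
    strongly connect the indices. If p and q are the only indices, A is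
    consistent and all pairs are edges. Either way efficiency is a system of
    linear inequalities a_ij w_j <= w_i. *)
Require Import Defs.
From mathcomp Require Import all_boot all_order all_algebra.
From mathcomp Require Import classical_sets reals convex.
From mathcomp Require Import interval_inference lra.

Set Implicit Arguments.
Unset Strict Implicit.
Unset Printing Implicit Defensive.

Import Order.TTheory GRing.Theory Num.Theory.
Local Open Scope ring_scope.

Section Edges.
Variables (R : realType) (n : nat).
Implicit Types (A C : 'M[R]_n) (v w : 'cV[R]_n).

Lemma PC_diag A i : PC A -> A i i = 1.
Proof.
move=> [posA recA]; have := recA i i => /(congr1 ( *%R (A i i))).
rewrite divff ?gt_eqF// => /eqP; rewrite -expr2 sqrp_eq1 ?ltW//.
by move/eqP.
Qed.

(** The ratio [x / y] already overshoots [a], so a ratio [x' / y'] with no larger error cannot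
    exceed it. *)
Lemma error_edge (a x y x' y' : R) : 0 < x -> 0 < y -> 0 < x' -> 0 < y' ->
  `|a - x' / y'| <= `|a - x / y| -> a * y <= x -> x' / x <= y' / y.
Proof.
move=> x0 y0 x'0 y'0 le_err edge.
have le_a : a <= x / y by rewrite ler_pdivlMr.
suff : x' / y' <= x / y.
  rewrite !ler_pdivrMr// mulrAC ler_pdivlMr// mulrAC ler_pdivlMr//.
  by rewrite [y' * x]mulrC.
move: le_err; rewrite (ler0_norm (x := a - x / y)) ?subr_le0//.
by rewrite ler_norml => /andP[+ _]; lra.
Qed.

Lemma efficient_of_edges A w (E : rel 'I_n) : positive_mx w ->
  (forall i j, connect E i j) ->
  (forall i j, E i j -> A i j * w j ord0 <= w i ord0) -> efficient A w.
Proof.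
move=> w0 conE edges; split=> // v v0 le_err.
have mono i j : connect E i j -> v i ord0 / w i ord0 <= v j ord0 / w j ord0.
  move=> /connectP[s]; elim: s i => [i _ -> //|k s IHs i /= /andP[Eik ks] jE].
  apply: le_trans (IHs _ ks jE).
  apply: error_edge (edges _ _ Eik) => //.
  by have := le_err i k; rewrite !mxE !big_ord1 !mxE.
(* With no indices there is no entry to read the factor from, and any scalar works. *)
case: n A w E w0 conE edges v v0 le_err mono => [|m] A' w' E w0 conE _ v v0 _ mono.
  by exists 0; apply/matrixP => -[].
exists (v ord0 ord0 / w' ord0 ord0); apply/matrixP => i j.
rewrite (ord1 j) mxE.
have -> : v ord0 ord0 / w' ord0 ord0 = v i ord0 / w' i ord0.
  by apply/le_anti; rewrite !mono.
by rewrite divfK// gt_eqF.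
Qed.

Lemma efficient_cut A w (M : {set 'I_n}) m0 i0 : PC A -> efficient A w ->
  m0 \in M -> i0 \notin M ->
  exists i m, [/\ i \notin M, m \in M & A i m * w m ord0 <= w i ord0].
Proof.
move=> [posA recA] [w0 effw] m0M i0M.
case: (boolP [exists i, exists m,
  [&& i \notin M, m \in M & A i m * w m ord0 <= w i ord0]]) => [|noedge].
  by move=> /existsP[i /existsP[m /and3P[]]]; exists i, m.
have lt_edge i m : i \notin M -> m \in M -> w i ord0 < A i m * w m ord0.
  move=> iM mM; rewrite ltNge; apply: contra noedge => edge.
  by apply/existsP; exists i; apply/existsP; exists m; rewrite iM mM.
pose F (k : 'I_n * 'I_n) := w k.1 ord0 / (A k.1 k.2 * w k.2 ord0).
(* Without an edge across the cut every ratio [F k] involved is below 1; the default [2^-1] keeps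
   [t] positive. *)
pose t := \big[Order.max/2^-1]_(k | (k.1 \notin M) && (k.2 \in M)) F k.
have t1 : t < 1.
  apply: bigmax_lt => [|[i m] /= /andP[iM mM]]; first lra.
  by rewrite /F ltr_pdivrMr ?mulr_gt0// mul1r lt_edge.
have t0 : 0 < t by apply: lt_le_trans (bigmax_ge_id _ _ _ _); lra.
have tP i m : i \notin M -> m \in M -> w i ord0 / (t * w m ord0) <= A i m.
  move=> iM mM; rewrite ler_pdivrMr ?mulr_gt0// mulrCA -ler_pdivrMr ?mulr_gt0//.
  by apply: (le_bigmax_cond _ F (j := (i, m))); rewrite /= iM mM.
(* Scaling by [t] on [M] raises only the ratios from outside [M] to [M], and these stay at most the
   entries of [A]; the reverse ratios are their reciprocals. *)
pose v : 'cV[R]_n := \col_i (if i \in M then t * w i ord0 else w i ord0).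
have [||c vE] := effw v.
- by move=> i j; rewrite mxE; case: ifP => _; rewrite ?mulr_gt0.
- have le_t i j : w i ord0 / w j ord0 <= w i ord0 / (t * w j ord0).
    by rewrite ler_pM2l// lef_pV2 ?posrE ?mulr_gt0// ger_pMl ?ltW.
  move=> i j; have [wi wj] := (w0 i ord0, w0 j ord0).
  rewrite !mxE !big_ord1 !mxE.
  case: (boolP (i \in M)) (boolP (j \in M)) => iM [] jM.
  + by rewrite invfM mulrACA divff ?gt_eqF// mul1r.
  + have := tP _ _ jM iM.
    rewrite -(invrK (A j i)) -recA -[w j ord0 / _]invrK invf_div.
    rewrite lef_pV2 ?posrE ?divr_gt0 ?mulr_gt0// => le1.
    have le2 : t * w i ord0 / w j ord0 <= w i ord0 / w j ord0.
      by rewrite ler_pM2r ?invr_gt0// ger_pMl ?ltW.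
    by rewrite !ler0_norm; lra.
  + have le1 := tP _ _ iM jM; have le2 := le_t i j.
    by rewrite !ger0_norm; lra.
  + by [].
have := congr1 (fun u : 'cV[R]_n => u i0 ord0) vE.
have := congr1 (fun u : 'cV[R]_n => u m0 ord0) vE.
rewrite /= !mxE m0M (negPf i0M) => /mulIf tc; rewrite -tc ?gt_eqF//.
move=> /eqP; rewrite eq_sym -subr_eq0 -[X in _ - X]mul1r -mulrBl mulf_eq0.
by rewrite subr_eq0 (lt_eqF t1) gt_eqF.
Qed.

(** Column [j] of [A] reproduces [A] without error, so an efficient [w] is proportional to it. *)
Lemma efficient_consistent A w i j : consistent A -> efficient A w ->
  A i j * w j ord0 <= w i ord0.
Proof.
move=> [PCA transA] [w0 effw]; have [posA recA] := PCA.
have [||c vE] := effw (\col_k A k j).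
- by move=> k l; rewrite mxE.
- by move=> k l; rewrite !mxE !big_ord1 !mxE -recA -transA subrr normr0.
have := congr1 (fun u : 'cV[R]_n => u i ord0) vE.
have := congr1 (fun u : 'cV[R]_n => u j ord0) vE.
by rewrite /= !mxE PC_diag// => cj ->; rewrite mulrAC -cj mul1r.
Qed.

Lemma efficient_perturbed A C w p q : PC A -> consistent C -> p != q ->
    (forall i j, (i, j) <> (p, q) -> (i, j) <> (q, p) -> A i j = C i j) ->
    C p q <= A p q -> efficient A w ->
  [/\ forall i, i != p -> i != q -> A p i * w i ord0 <= w p ord0,
      forall i, i != p -> i != q -> A i q * w q ord0 <= w i ord0
    & A q p * w p ord0 <= w q ord0].
Proof.
move=> PCA [PCC transC] pq AC le_pq effw; have w0 := effw.1.
have [[posA recA] [posC recC]] := (PCA, PCC).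
(* This rescaling turns [C] into the all-ones matrix, so its edges just compare entries of [u]. *)
pose u i := C p i * w i ord0.
have uE i j : (C i j * w j ord0 <= w i ord0) = (u j <= u i).
  by rewrite /u (transC p i j) -mulrA ler_pM2l.
(* Across such a cut [C] has no edge, so the edge of [A] sits at a perturbed entry. At [(p, q)] the
   larger entry only makes an edge harder to have, which leaves [(q, p)]. *)
have cut (M : {set 'I_n}) m0 i0 :
    (forall i m, i \notin M -> m \in M -> u i < u m) ->
    m0 \in M -> i0 \notin M ->
    [/\ p \in M, q \notin M & A q p * w p ord0 <= w q ord0].
  move=> upM m0M i0M.
  have [i [m [iM mM edge]]] := efficient_cut PCA effw m0M i0M.
  have lt_um := upM _ _ iM mM.
  have [[ip mq]|/eqP ipmq] := (i, m) =P (p, q).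
    move: edge lt_um; rewrite ip mq ltNge -uE => edge /negP[].
    by apply: le_trans edge; rewrite ler_pM2r.
  have [[iq mp]|/eqP iqmp] := (i, m) =P (q, p).
    by rewrite -iq -mp.
  move: edge; rewrite AC; [|exact/eqP|exact/eqP].
  by rewrite uE leNgt lt_um.
have pair_neq (i j k l : 'I_n) : (i != k) || (j != l) -> (i, j) <> (k, l).
  by move=> /orP[] /eqP ? [].
split=> [i ip iq|i ip iq|].
- rewrite AC ?uE; [|by apply: pair_neq; rewrite iq orbT
                   |by apply: pair_neq; rewrite pq].
  (* Were the edge missing, this level set would omit [p]; in the next case it would contain [q].
     Both contradict [cut]. *)
  rewrite leNgt; apply/negP => lt_u.
  have [|||] := cut [set m | u p < u m] i p; rewrite ?inE ?ltxx// => j m.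
  by rewrite !inE -leNgt; apply: le_lt_trans.
- rewrite AC ?uE; [|by apply: pair_neq; rewrite ip
                   |by apply: pair_neq; rewrite iq].
  rewrite leNgt; apply/negP => lt_u.
  have [|||] := cut [set m | u q <= u m] q i; rewrite ?inE ?lexx -?ltNge// => j m.
  by rewrite !inE -ltNge; apply: lt_le_trans.
- have [|lt_u] := leP (u p) (u q).
    rewrite -uE; apply: le_trans; rewrite ler_pM2r// recA recC.
    by rewrite lef_pV2 ?posrE.
  have [|||] := cut [set m | u q < u m] p q; rewrite ?inE ?ltxx// => j m.
  by rewrite !inE -leNgt; apply: le_lt_trans.
Qed.

(** One relation [E] serves all efficient vectors, so the edge inequalities, linear in [w], pass to
    convex combinations. *)
Lemma convex_efficient_set A (E : rel 'I_n) : (forall i j, connect E i j) ->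
    (forall w, efficient A w ->
      forall i j, E i j -> A i j * w j ord0 <= w i ord0) ->
  convex_set (efficient_set A).
Proof.
move=> conE edges x y l; rewrite !inE => effx effy.
have l0 : 0 <= l%:num by [].
have l1 : 0 <= 1 - l%:num by rewrite subr_ge0.
apply: (efficient_of_edges (E := E)) => // [i j|i j Eij].
  have [xi yi] := (effx.1 i j, effy.1 i j).
  rewrite !mxE /unstable.onem; have := mulr_ge0 l1 (ltW yi).
  have [->|lN0] := eqVneq l%:num 0; first by rewrite subr0 mul0r mul1r add0r.
  by move=> ?; rewrite ltr_pwDl// mulr_gt0// lt_neqAle eq_sym lN0.
rewrite !mxE mulrDr [A i j * _]mulrCA [A i j * (_ * y _ _)]mulrCA.
by apply: lerD; apply: ler_wpM2l => //; apply: edges.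
Qed.

Lemma convex_efficient_set_consistent A : consistent A ->
  convex_set (efficient_set A).
Proof.
move=> consA; apply: (convex_efficient_set (E := fun _ _ => true)).
  by move=> i j; apply: connect1.
by move=> w effw i j _; apply: efficient_consistent.
Qed.

Lemma convex_efficient_set_perturbed A C p q : PC A -> consistent C -> p != q ->
    (forall i j, (i, j) <> (p, q) -> (i, j) <> (q, p) -> A i j = C i j) ->
    C p q <= A p q ->
  convex_set (efficient_set A).
Proof.
move=> PCA consC pq AC le_pq.
case: (pickP [pred k | (k != p) && (k != q)]) => [k /= /andP[kp kq]|only].
  pose E i j := [|| [&& i == p, j != p & j != q], [&& i != p, i != q & j == q]
                  | (i == q) && (j == p)].
  have Epi i : i != p -> i != q -> connect E p i.
    by move=> ip iq; apply: connect1; rewrite /E eqxx ip iq.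
  have Eiq i : i != p -> i != q -> connect E i q.
    by move=> ip iq; apply: connect1; rewrite /E eqxx ip iq orbT.
  have Eqp : connect E q p by apply: connect1; rewrite /E !eqxx !orbT.
  (* [E] has no direct edge from [p] to [q]; the third index [k] links them and closes the cycle. *)
  have Epq : connect E p q := connect_trans (Epi k kp kq) (Eiq k kp kq).
  have from_p i : connect E p i.
    have [->|ip] := eqVneq i p => //; have [->|iq] := eqVneq i q => //.
    exact: Epi.
  have to_p i : connect E i p.
    have [->|ip] := eqVneq i p => //; have [->|iq] := eqVneq i q => //.
    exact: connect_trans (Eiq _ ip iq) Eqp.
  apply: (convex_efficient_set (E := E)) => [i j|w effw i j].
    exact: connect_trans (to_p i) (from_p j).
  have [pP qP qpP] := efficient_perturbed PCA consC pq AC le_pq effw.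
  by case/or3P => [/and3P[/eqP-> ? ?]|/and3P[? ? /eqP->]|/andP[/eqP-> /eqP->]];
    [apply: pP|apply: qP|].
(* On two indices consistency follows from reciprocity and the unit diagonal. *)
apply: convex_efficient_set_consistent; split=> //.
have [posA recA] := PCA.
have only_pq i : i = p \/ i = q.
  by have := only i; rewrite /=; case: eqP; case: eqP; auto.
have inv i j : A i j * A j i = 1 by rewrite (recA i j) divff// gt_eqF.
move=> i j k; case: (only_pq i) => ->; case: (only_pq j) => ->;
  case: (only_pq k) => ->; by rewrite ?inv !PC_diag// ?mul1r ?mulr1.
Qed.

End Edges.

Theorem theorem17 (R : realType) (n : nat) (A : 'M[R]_n)
    (hA : simple_perturbed_consistent A) :
  convex_set (efficient_set A).
Proof.
have [PCA [C [p [q [consC pq AC]]]]] := hA.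
have [le_pq|/ltW le_pq] := leP (C p q) (A p q).
  exact: convex_efficient_set_perturbed AC le_pq.
(* By reciprocity, decreasing the entry at [(p, q)] increases the one at [(q, p)]. *)
apply: (convex_efficient_set_perturbed (p := q) (q := p) PCA consC).
- by rewrite eq_sym.
- by move=> i j ? ?; apply: AC.
- by rewrite PCA.2 consC.1.2 lef_pV2 ?posrE ?PCA.1 ?consC.1.1.
Qed.
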